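(* Let $m\ge 3$ and $n\ge 1$ be integers. Up to switching isomorphism, the number of distinct signatures on the Book graph $B(m,n)$ is $n+1$.
   Context: For integers $m\ge 3$, $n\ge 1$, the Book graph $B(m,n)$ is the simple graph with vertex set $\{u,v\}\cup\{u_j^l : 1\le l\le n,\ 1\le j\le m-2\}$ consisting of the $n$ cycles $C_m^l = u\,u_1^l\,u_2^l\cdots u_{m-2}^l\,v\,u$ ($l=1,\dots,n$), which pairwise share exactly the edge $uv$. A signature on a graph $G$ is a subset $\Sigma\subseteq E(G)$ (the set of negative edges; all other edges are positive). Switching (resigning) at a vertex $x$ changes the sign of every edge incident to $x$; two signatures are switching equivalent if one is obtained from the other by a sequence of switchings. Two signatures $\Sigma_1,\Sigma_2$ on $G$ are switching isomorphic if there is a signature $\Sigma_2'$ switching equivalent to $\Sigma_2$ and a graph automorphism $f$ of $G$ such that $xy\in\Sigma_1$ if and only if $f(x)f(y)\in\Sigma_2'$. *)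

(* Defs.v *)
From mathcomp Require Import all_boot all_fingroup.

Set Implicit Arguments.
Unset Strict Implicit.
Unset Printing Implicit Defensive.

Section SignedGraphs.

(* A simple graph on V is given by its adjacency relation e, which is meant to
   be symmetric and irreflexive; the edge xy is the set [set x; y]. *)
Variables (V : finType) (e : rel V).
Implicit Types (S : {set {set V}}) (f : {perm V}).

Definition edges : {set {set V}} :=
  [set [set p.1; p.2] | p : V * V & e p.1 p.2].

Definition signatures : {set {set {set V}}} := powerset edges.

Definition switch (x : V) S : {set {set V}} :=
  [set d in edges | (d \in S) (+) (x \in d)].

Definition switching_equiv : rel {set {set V}} :=
  connect [rel S S' | [exists x, S' == switch x S]].

Definition graph_aut f : bool :=
  [forall x, forall y, e (f x) (f y) == e x y].

Definition switching_iso : rel {set {set V}} := fun S1 S2 =>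
  [exists S2', switching_equiv S2 S2' &&
    [exists f : {perm V}, graph_aut f &&
      [forall x, forall y,
        ([set x; y] \in S1) == ([set f x; f y] \in S2')]]].

(* The number of signatures up to switching isomorphism; switching_iso is an
   equivalence relation on signatures (switching_iso_equiv below), so this
   counts genuine equivalence classes. *)
Definition num_switching_iso_classes : nat :=
  #|equivalence_partition switching_iso signatures|.

Lemma switch_sig x S : switch x S \in signatures.
Proof. by rewrite powersetE; apply/subsetP=> d; rewrite inE => /andP[]. Qed.

Lemma switchK x S : S \in signatures -> switch x (switch x S) = S.
Proof.
rewrite powersetE => /subsetP sSE; apply/setP=> d; rewrite !inE.
case dE: (d \in edges) => /=; first by rewrite -addbA addbb addbF.
by apply/esym/negP => /sSE; rewrite dE.
Qed.

Lemma switching_equiv_sig S S' :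
  switching_equiv S S' -> S \in signatures -> S' \in signatures.
Proof.
case/connectP=> p; elim: p S => [|T p IHp] S /=; first by move=> _ ->.
by case/andP=> /existsP[x /eqP->] pp lp _; apply: IHp pp lp _; apply: switch_sig.
Qed.

Lemma switching_equiv_sym S S' : S \in signatures ->
  switching_equiv S S' -> switching_equiv S' S.
Proof.
move=> sS /connectP[p]; elim: p S sS => [|T p IHp] S sS /=.
  by move=> _ ->; apply: connect0.
case/andP=> /existsP[x /eqP defT] pp lp.
have sT : T \in signatures by rewrite defT switch_sig.
apply: connect_trans (IHp T sT pp lp) _; apply: connect1.
by apply/existsP; exists x; rewrite defT switchK.
Qed.

Lemma graph_autP f : reflect (forall x y, e (f x) (f y) = e x y) (graph_aut f).
Proof.
apply: (iffP forallP) => [H x y|H x]; first by have/forallP/(_ y)/eqP := H x.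
by apply/forallP=> y; rewrite H.
Qed.

Lemma edgesP d :
  reflect (exists x y, e x y /\ d = [set x; y]) (d \in edges).
Proof.
apply: (iffP imsetP) => [[[x y]]|[x [y [exy ->]]]].
  by rewrite inE /= => exy ->; exists x, y.
by exists (x, y); rewrite ?inE.
Qed.

Lemma aut_edges f (d : {set V}) : graph_aut f -> (f @: d \in edges) = (d \in edges).
Proof.
move/graph_autP=> fA; apply/edgesP/edgesP => -[x [y [exy dE]]].
  exists (f^-1 x)%g, (f^-1 y)%g; split; first by rewrite -fA !permKV.
  apply: (imset_inj (@perm_inj _ f)).
  by rewrite dE imsetU1 imset_set1 !permKV.
by exists (f x), (f y); rewrite fA dE imsetU1 imset_set1.
Qed.

Lemma switching_isoP S1 S2 : S1 \in signatures -> S2 \in signatures ->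
  reflect (exists2 f : {perm V}, graph_aut f &
             switching_equiv S2 [set f @: (d : {set V}) | d in S1])
          (switching_iso S1 S2).
Proof.
rewrite !powersetE => sS1 sS2.
apply: (iffP existsP) => [[S2' /andP[eqS /existsP[f /andP[fA /forallP Hf]]]]|].
  exists f => //; suff -> : [set f @: (d : {set V}) | d in S1] = S2' by [].
  have sS2' : S2' \subset edges.
    by rewrite -powersetE (switching_equiv_sig eqS) // powersetE.
  apply/setP=> d; apply/imsetP/idP => [[d' d'S ->]|dS].
    have/edgesP[x [y [exy d'E]]] := subsetP sS1 _ d'S.
    have/forallP/(_ y)/eqP := Hf x; rewrite -d'E d'S => /esym.
    by rewrite d'E imsetU1 imset_set1.
  have/edgesP[x [y [exy dE]]] := subsetP sS2' _ dS.
  exists [set (f^-1 x)%g; (f^-1 y)%g]; last by rewrite imsetU1 imset_set1 !permKV.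
  by have/forallP/(_ (f^-1 y)%g)/eqP -> := Hf (f^-1 x)%g; rewrite !permKV -dE.
case=> f fA eqS; exists [set f @: (d : {set V}) | d in S1]; rewrite eqS /=.
apply/existsP; exists f; rewrite fA /=; apply/forallP=> x; apply/forallP=> y.
have -> : [set f x; f y] = f @: [set x; y] by rewrite imsetU1 imset_set1.
by rewrite mem_imset //; apply: imset_inj; apply: perm_inj.
Qed.

Lemma aut_sig f S : graph_aut f -> S \in signatures ->
  [set f @: (d : {set V}) | d in S] \in signatures.
Proof.
rewrite !powersetE => fA sS; apply/subsetP=> _ /imsetP[d dS ->].
by rewrite aut_edges // (subsetP sS).
Qed.

Lemma aut_switch f x S : graph_aut f ->
  [set f @: (d : {set V}) | d in switch x S]
  = switch (f x) [set f @: (d : {set V}) | d in S].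
Proof.
move=> fA; have fI := imset_inj (@perm_inj _ f).
apply/setP=> d; have -> : d = f @: [set y | f y \in d].
  apply/setP=> y; apply/idP/imsetP => [yd|[z]]; last by rewrite inE => zd ->.
  by exists (f^-1 y)%g; rewrite ?inE permKV.
move: [set y | f y \in d] => d'; rewrite (mem_imset _ _ fI) !inE aut_edges //.
by rewrite (mem_imset _ _ fI) (mem_imset _ _ (@perm_inj _ f)).
Qed.

Lemma aut_switching_equiv f S S' : graph_aut f -> switching_equiv S S' ->
  switching_equiv [set f @: (d : {set V}) | d in S]
                  [set f @: (d : {set V}) | d in S'].
Proof.
move=> fA /connectP[p]; elim: p S => [|T p IHp] S /=.
  by move=> _ ->; apply: connect0.
case/andP=> /existsP[x /eqP defT] pp lp.
apply: connect_trans (IHp T pp lp); apply: connect1; apply/existsP; exists (f x).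
by rewrite defT aut_switch.
Qed.

Lemma aut_mul f g : graph_aut f -> graph_aut g -> graph_aut (f * g)%g.
Proof.
by move=> /graph_autP fA /graph_autP gA; apply/graph_autP=> x y; rewrite !permM gA fA.
Qed.

Lemma aut_inv f : graph_aut f -> graph_aut f^-1%g.
Proof. by move/graph_autP=> fA; apply/graph_autP=> x y; rewrite -fA !permKV. Qed.

Lemma imset_mul f g S : [set (f * g)%g @: (d : {set V}) | d in S]
  = [set g @: (d : {set V}) | d in [set f @: (d : {set V}) | d in S]].
Proof.
rewrite -imset_comp; apply: eq_imset => d /=; rewrite -imset_comp.
by apply: eq_imset => x; rewrite permM.
Qed.

Lemma imset_one S : [set (1%g : {perm V}) @: (d : {set V}) | d in S] = S.
Proof.
rewrite -[RHS]imset_id; apply: eq_imset => d.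
by rewrite -[RHS]imset_id; apply: eq_imset => x; rewrite perm1.
Qed.

Lemma switching_iso_equiv :
  {in signatures & &, equivalence_rel switching_iso}.
Proof.
have sym S1 S2 : S1 \in signatures -> S2 \in signatures ->
    switching_iso S1 S2 -> switching_iso S2 S1.
  move=> s1 s2 /(switching_isoP s1 s2)[f fA eqS].
  apply/switching_isoP => //; exists f^-1%g; first exact: aut_inv.
  have:= aut_switching_equiv (aut_inv fA) (switching_equiv_sym s2 eqS).
  by rewrite -imset_mul mulgV imset_one.
have trans S1 S2 S3 : S1 \in signatures -> S2 \in signatures ->
    S3 \in signatures ->
    switching_iso S1 S2 -> switching_iso S2 S3 -> switching_iso S1 S3.
  move=> s1 s2 s3 /(switching_isoP s1 s2)[f fA eqf].
  move=> /(switching_isoP s2 s3)[g gA eqg].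
  apply/switching_isoP => //; exists (f * g)%g; first exact: aut_mul.
  by rewrite imset_mul; apply: connect_trans eqg (aut_switching_equiv gA eqf).
move=> S1 S2 S3 s1 s2 s3; split.
  apply/switching_isoP => //; exists 1%g; last by rewrite imset_one; apply: connect0.
  by apply/graph_autP=> x y; rewrite !perm1.
move=> S12; apply/idP/idP; last exact: trans.
exact: trans (sym _ _ s1 s2 S12).
Qed.

End SignedGraphs.

Definition book_vertex (m n : nat) : finType := (bool + 'I_n * 'I_(m - 2))%type.

(* u and v are inl false and inl true; with 0-based indices, inr (l, j) is the
   (j+1)-th internal vertex of the (l+1)-th cycle. *)
Definition book_u m n : book_vertex m n := inl false.
Definition book_v m n : book_vertex m n := inl true.

Definition book_cycle m n (l : 'I_n) : seq (book_vertex m n) :=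
  book_u m n :: rcons [seq inr (l, j) | j <- enum 'I_(m - 2)] (book_v m n).

Definition book m n : rel (book_vertex m n) := fun x y =>
  [exists l : 'I_n, let c := book_cycle m l in
    [&& x \in c, y \in c & (next c x == y) || (next c y == x)]].

Lemma book_sym m n : symmetric (@book m n).
Proof. by move=> x y; apply: eq_existsb => l /=; rewrite andbCA orbC. Qed.

Lemma book_cycle_uniq m n (l : 'I_n) : uniq (book_cycle m l).
Proof.
rewrite /= mem_rcons inE rcons_uniq /= map_inj_uniq ?enum_uniq; last first.
  by move=> i j [].
by rewrite andbT; apply/andP; split; apply/negP=> /mapP[].
Qed.

Lemma book_irr m n : irreflexive (@book m n).
Proof.
move=> x; apply/negbTE/negP=> /existsP[l] /and3P[xc _].
rewrite orbb => /eqP.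
have := book_cycle_uniq m l.
have : 1 < size (book_cycle m l) by rewrite /= size_rcons.
have [i s rotc] := rot_to xc.
move=> sz uc; rewrite -(next_rot i uc) rotc.
move: sz uc; rewrite -(size_rot i) -(rot_uniq i) rotc.
case: s {rotc} => //= y s _ /andP[] H _; rewrite eqxx => yx.
by rewrite yx inE eqxx in H.
Qed.

(* Main.v *)
(** The number of pages (the cycles through [uv]) carrying an odd number of negative
    edges is a complete invariant.  Switching at a vertex changes the signs of zero
    or two edges of a cycle, so it preserves the parity of every page; conversely two
    signatures with the same page parities differ by a coboundary, hence are
    switching equivalent.  An automorphism permutes the pages: if [n > 1] it
    preserves [{u, v}], the vertices of degree at least 3, and the pages are the
    components of the rest.  Since every permutation of the pages is induced by an
    automorphism, only the number of odd pages matters, and each of [0, ..., n]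
    occurs. *)
Require Import Defs.
From mathcomp Require Import all_boot all_fingroup.
From mathcomp Require Import zify.

(** * Switching along a list of vertices *)

Section Switching.
Variables (V : finType) (e : rel V).
Implicit Types (S : {set {set V}}) (x y : V) (s : seq V).

Definition switch_seq s S := foldr (switch e) S s.

Lemma switching_equiv_seq s S : switching_equiv e S (switch_seq s S).
Proof.
elim: s => [|x s IHs]; first exact: connect0.
by apply: connect_trans IHs (connect1 _); apply/existsP; exists x.
Qed.

Lemma switch_seq_sig s S : S \in signatures e -> switch_seq s S \in signatures e.
Proof. by move/(switching_equiv_sig (switching_equiv_seq s S)). Qed.

Lemma in_set2_addb x y z : x != y -> (z \in [set x; y]) = (x == z) (+) (y == z).
Proof.
rewrite in_set2 [z == x]eq_sym [z == y]eq_sym.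
by case: (eqVneq x z) => [->|//]; rewrite eq_sym => /negPf->.
Qed.

Lemma mem_switch x y z S : [set x; y] \in edges e -> x != y ->
  ([set x; y] \in switch e z S) = ([set x; y] \in S) (+) ((x == z) (+) (y == z)).
Proof. by move=> xyE xy; rewrite inE xyE in_set2_addb. Qed.

(** Switching twice at a vertex cancels; [uniq] makes membership in [s] agree with the parity of the
    number of switchings. *)
Lemma mem_switch_seq s x y S : uniq s -> [set x; y] \in edges e -> x != y ->
  ([set x; y] \in switch_seq s S) = ([set x; y] \in S) (+) ((x \in s) (+) (y \in s)).
Proof.
move=> us xyE xy; elim: s us => [|z s IHs] /=; first by rewrite addbF.
case/andP=> zs us; rewrite mem_switch // IHs // !inE.
have D t : (t == z) || (t \in s) = (t == z) (+) (t \in s).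
  by case: (eqVneq t z) => [->|//]; rewrite (negPf zs).
rewrite !D; case: (_ \in S); case: (x == z); case: (y == z);
  by case: (x \in s); case: (y \in s).
Qed.

Lemma mem_imset_edge (f : {perm V}) x y S :
  ([set f x; f y] \in [set f @: (d : {set V}) | d in S]) = ([set x; y] \in S).
Proof.
have -> : [set f x; f y] = f @: [set x; y] by rewrite imsetU1 imset_set1.
rewrite mem_imset //; exact/imset_inj/perm_inj.
Qed.

End Switching.

(** * Parity sums and permutations of finite predicates *)

Lemma telescope_addb (g : nat -> bool) k :
  \big[addb/false]_(0 <= i < k) (g i (+) g i.+1) = g 0 (+) g k.
Proof.
elim: k => [|k IHk]; first by rewrite big_nil addbb.
by rewrite big_nat_recr //= IHk; case: (g k); case: (g 0); case: (g k.+1).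
Qed.

(** Boolean tuples with equally many [true] entries are rearrangements of each other, and the
    rearrangement is the permutation sought. *)
Lemma eq_card_perm n (p q : pred 'I_n) : #|p| = #|q| ->
  exists s : 'S_n, forall i, q (s i) = p i.
Proof.
move=> pq; have cnt (r : pred 'I_n) b :
    count (pred1 b) [tuple r i | i < n] = if b then #|r| else n - #|r|.
  have -> : count (pred1 b) [tuple r i | i < n] = #|[pred i | r i == b]|.
    by rewrite /= count_map enumT -size_filter cardE.
  case: b; first by apply: eq_card => i; rewrite !inE eqb_id.
  rewrite -[X in X - _](card_ord n) -(cardC r) addKn.
  by apply: eq_card => i; rewrite !inE eqbF_neg.
have: perm_eq [tuple p i | i < n] [tuple q i | i < n].
  by apply/allP=> b _; rewrite /= !cnt pq.
case/tuple_permP=> s ps; exists s => i.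
by have := congr1 (fun t => tnth t i) (val_inj ps); rewrite !tnth_mktuple.
Qed.

(** * Vertices and edges along the cycles of the book *)

Section Book.
Variables (m n : nat).
Hypothesis hm : 3 <= m.
Notation V := (book_vertex m n).
Notation u := (book_u m n).
Notation v := (book_v m n).
Notation E := (edges (@book m n)).
Notation sigs := (signatures (@book m n)).
Implicit Types (l : 'I_n) (x y : V) (S T : {set {set V}}) (f : {perm V}).

(* The default value [u] of [nth] makes the cycle close up: [vtx l m = u]. *)
Definition vtx l i : V := nth u (book_cycle m l) i.
Definition edge l i : {set V} := [set vtx l i; vtx l i.+1].

Lemma size_book_cycle l : size (book_cycle m l) = m.
Proof. by rewrite /= size_rcons size_map size_enum_ord; lia. Qed.

Lemma vtx0 l : vtx l 0 = u. Proof. by []. Qed.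

Lemma vtxm l : vtx l m = u.
Proof. by rewrite /vtx nth_default ?size_book_cycle. Qed.

Lemma vtx_inr l (j : 'I_(m - 2)) : vtx l j.+1 = inr (l, j).
Proof.
rewrite /vtx /= nth_rcons size_map size_enum_ord ltn_ord.
by rewrite (nth_map j) ?size_enum_ord // nth_ord_enum.
Qed.

Lemma vtx_last l : vtx l m.-1 = v.
Proof.
have -> : m.-1 = (m - 2).+1 by lia.
by rewrite /vtx /= nth_rcons size_map size_enum_ord ltnn eqxx.
Qed.

(** The index [m] is included, with [u] occurring a second time, so that both ends of [edge l i] can
    be analysed for every [i < m]. *)
Variant vtx_spec l i : V -> Type :=
| VtxFirst of i = 0 : vtx_spec l i u
| VtxLast of i = m.-1 : vtx_spec l i v
| VtxEnd of i = m : vtx_spec l i u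
| VtxInner (j : 'I_(m - 2)) of i = j.+1 : vtx_spec l i (inr (l, j)).

Lemma vtxP l i : i <= m -> vtx_spec l i (vtx l i).
Proof.
move=> im; case: (eqVneq i 0) => [->|i0]; first by rewrite vtx0; constructor 1.
case: (eqVneq i m) => [->|im']; first by rewrite vtxm; constructor 3.
case: (eqVneq i m.-1) => [->|im1]; first by rewrite vtx_last; constructor 2.
have H : i.-1 < m - 2 by lia.
have -> : i = (Ordinal H).+1 by rewrite /=; lia.
by rewrite vtx_inr; apply: VtxInner.
Qed.

Lemma vtx_inj l i j : i < m -> j < m -> vtx l i = vtx l j -> i = j.
Proof.
by move=> im jm /eqP; rewrite nth_uniq ?size_book_cycle ?book_cycle_uniq // => /eqP.
Qed.

Lemma vtx_eq l i j : i <= m -> j <= m -> vtx l i = vtx l j ->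
  [\/ i = j, i = 0 /\ j = m | i = m /\ j = 0].
Proof.
move=> im jm; case: (eqVneq i m) => [->|im']; case: (eqVneq j m) => [->|jm'].
- by constructor 1.
- rewrite vtxm -(vtx0 l) => /vtx_inj <-; try lia; by constructor 3.
- rewrite vtxm -(vtx0 l) => /vtx_inj ->; try lia; by constructor 2.
- by move/vtx_inj => ->; try lia; constructor 1.
Qed.

Lemma vtx_neq l i : i < m -> vtx l i != vtx l i.+1.
Proof. by move=> im; apply/eqP=> /vtx_eq[]; lia. Qed.

Lemma mem_book_cycle_inr l l' j : (inr (l', j) \in book_cycle m l) = (l' == l).
Proof.
rewrite inE mem_rcons inE /=; apply/mapP/eqP => [[j' _ []]//|->].
by exists j; rewrite ?mem_enum.
Qed.

Lemma mem_book_cycle_inl l b : inl b \in book_cycle m l.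
Proof. by rewrite inE mem_rcons inE; case: b; rewrite eqxx ?orbT. Qed.

Lemma mem_vtx l i : vtx l i \in book_cycle m l.
Proof.
case: (ltnP i m) => im; first by rewrite mem_nth ?size_book_cycle.
by rewrite /vtx nth_default ?size_book_cycle ?mem_book_cycle_inl.
Qed.

Lemma next_vtx l i : i < m -> next (book_cycle m l) (vtx l i) = vtx l i.+1.
Proof.
move=> im; rewrite next_nth mem_vtx index_uniq ?book_cycle_uniq //.
by rewrite size_book_cycle.
Qed.

Lemma bookP x y :
  reflect (exists l i, i < m /\ (x = vtx l i /\ y = vtx l i.+1 \/
                                 y = vtx l i /\ x = vtx l i.+1))
          (book x y).
Proof.
apply: (iffP existsP) => [[l /and3P[xc yc H]]|[l [i [im H]]]].
  case/orP: H => /eqP H.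
    case/(nthP u): xc => i; rewrite size_book_cycle -/(vtx l i) => im xE.
    by exists l, i; split=> //; left; rewrite -H -xE next_vtx.
  case/(nthP u): yc => i; rewrite size_book_cycle -/(vtx l i) => im yE.
  by exists l, i; split=> //; right; rewrite -H -yE next_vtx.
exists l; case: H => -[-> ->]; apply/and3P; split; rewrite ?mem_vtx //;
  by rewrite (next_vtx l i im) eqxx ?orbT.
Qed.

Lemma mem_edgesP d : reflect (exists l i, i < m /\ d = edge l i) (d \in E).
Proof.
apply: (iffP (edgesP _ _)) => [[x [y [/bookP[l [i [im H]]] ->]]]|[l [i [im ->]]]].
  by exists l, i; split=> //; case: H => -[-> ->] //; rewrite setUC.
by exists (vtx l i), (vtx l i.+1); split=> //; apply/bookP; exists l, i; auto.
Qed.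

Lemma edge_edges l i : i < m -> edge l i \in E.
Proof. by move=> im; apply/mem_edgesP; exists l, i. Qed.

Lemma edge_last l : edge l m.-1 = [set u; v].
Proof. by rewrite /edge prednK ?vtxm ?vtx_last 1?setUC //; lia. Qed.

(** Two indices with the same edge would each be the cyclic successor of the other, which [3 <= m]
    excludes. *)
Lemma edge_inj l i j : i < m -> j < m -> edge l i = edge l j -> i = j.
Proof.
move=> im jm /setP H; have := H (vtx l i); have := H (vtx l i.+1).
rewrite !inE !eqxx orbT /= => /esym/orP[]/eqP /vtx_eq A /esym/orP[]/eqP /vtx_eq B.
all: by case: A; try lia; case: B; lia.
Qed.

Lemma edge_sub_cycle l l' i : (edge l' i \subset book_cycle m l) =
  (vtx l' i \in book_cycle m l) && (vtx l' i.+1 \in book_cycle m l).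
Proof.
apply/subsetP/andP => [H|[H1 H2] x /set2P[]-> //].
by split; apply: H; rewrite !inE eqxx ?orbT.
Qed.

(** * Pages and the parity invariant *)

Definition page l : {set {set V}} := [set d in E | d \subset book_cycle m l].

(** Each cycle is an induced subgraph: an edge of another page with both ends on cycle [l] can only
    be [uv], which has index [m.-1] on every page. *)
Lemma pageE l : page l = [set edge l (i : 'I_m) | i : 'I_m].
Proof.
apply/setP=> d; rewrite inE; apply/andP/imsetP => [[]|[i _ ->]]; last first.
  by rewrite edge_edges //; split=> //; rewrite edge_sub_cycle !mem_vtx.
case/mem_edgesP=> l' [i [im ->]]; rewrite edge_sub_cycle => /andP[A B].
case: (eqVneq l' l) => [->|l'l]; first by exists (Ordinal im).
have mm : m.-1 < m by lia.
exists (Ordinal mm) => //=; rewrite edge_last -(edge_last l').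
congr (edge _ _); move: A B.
case: (vtxP l' i (ltnW im)) => [->|->|im'|j _] //; last 2 first.
- by lia.
- by rewrite mem_book_cycle_inr (negPf l'l).
(* Remaining case [i = 0]: the other end [vtx l' 1] is an inner vertex of page [l'], hence off cycle
   [l]. *)
have H0 : 0 < m - 2 by lia.
by move=> _; rewrite (vtx_inr l' (Ordinal H0)) mem_book_cycle_inr (negPf l'l).
Qed.

Lemma page_edge_inj l : injective (fun i : 'I_m => edge l i).
Proof. by move=> i j H; apply/val_inj/(edge_inj l _ _ _ _ H). Qed.

Lemma card_page l : #|page l| = m.
Proof. by rewrite pageE card_imset ?card_ord //; apply: page_edge_inj. Qed.

Lemma page_inj : injective page.
Proof.
move=> l l' pp; have H0 : 0 < m - 2 by lia.
have : edge l 0 \in page l' by rewrite -pp inE edge_edges ?edge_sub_cycle ?mem_vtx //; lia.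
rewrite inE edge_sub_cycle (vtx_inr l (Ordinal H0)) mem_book_cycle_inr.
by case/and3P=> _ _ /eqP.
Qed.

Definition odd_page S l : bool := \big[addb/false]_(0 <= i < m) (edge l i \in S).

(** The sum along the cycle suits telescoping; this sum over the edge set suits automorphisms, which
    need not respect the numbering. *)
Lemma odd_pageE S l : odd_page S l = \big[addb/false]_(d in page l) (d \in S).
Proof.
rewrite /odd_page big_mkord pageE big_imset //.
by move=> i j _ _; apply: page_edge_inj.
Qed.

(** The change is the sum of the indicator of [x] at both ends of each edge; it telescopes to zero
    since the walk starts and ends at [u]. *)
Lemma odd_page_switch x S l : odd_page (switch (@book m n) x S) l = odd_page S l.
Proof.
rewrite /odd_page.
rewrite (eq_big_nat _ _ (F2 := fun i => (edge l i \in S) (+)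
    ((vtx l i == x) (+) (vtx l i.+1 == x)))); last first.
  by move=> i /= im; rewrite mem_switch ?edge_edges ?vtx_neq.
rewrite big_split /= (telescope_addb (fun i => vtx l i == x)).
by rewrite vtxm vtx0 addbb addbF.
Qed.

Lemma odd_page_equiv S T l : switching_equiv (@book m n) S T ->
  odd_page S l = odd_page T l.
Proof.
case/connectP=> p; elim: p S => [|R p IHp] S /=; first by move=> _ ->.
by case/andP=> /existsP[x /eqP RE] /IHp H /H <-; rewrite RE odd_page_switch.
Qed.

Lemma equiv_odd_page S T : S \in sigs -> T \in sigs ->
  odd_page S =1 odd_page T -> switching_equiv (@book m n) S T.
Proof.
move=> sS sT ST; pose D d := (d \in S) (+) (d \in T).
pose g l k := \big[addb/false]_(0 <= i < k) D (edge l i).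
have gS l k : g l k.+1 = g l k (+) D (edge l k) by rewrite /g big_nat_recr.
have gm l : g l m = false.
  by rewrite /g big_split /= -[LHS]/(odd_page S l (+) odd_page T l) ST addbb.
(* Switching at the vertices of odd potential turns [S] into [T]: the potential
   of a vertex is the parity of the disagreements on the way to it from [u]. *)
pose phi (x : V) : bool := match x with
  | inl b => b && D [set u; v] | inr lj => g lj.1 (lj.2 : nat).+1 end.
have phiE l i : i <= m -> phi (vtx l i) = g l i.
  case/(vtxP l) => [->|->|->|j ->] //=; rewrite ?gm // ?/g ?big_nil //.
  (* Only [v] is left. As [g l m] vanishes, the potential gathered on the way to [v] along page [l]
     is the disagreement on [uv], whatever [l] is. *)
  rewrite -/(g l m.-1); have := gS l m.-1; rewrite prednK ?gm ?edge_last; last lia.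
  by case: (D _); case: (g _ _).
have inphi x : (x \in enum phi) = phi x by rewrite mem_enum.
suff <- : switch_seq _ (@book m n) (enum phi) S = T by apply: switching_equiv_seq.
apply/setP=> d; case: (boolP (d \in E)) => [|dE]; last first.
  have out R : R \in sigs -> d \in R = false.
    by rewrite powersetE => /subsetP sR; apply/negP=> /sR; rewrite (negPf dE).
  by rewrite !out // switch_seq_sig.
case/mem_edgesP=> l [i [im ->]].
rewrite mem_switch_seq ?enum_uniq ?vtx_neq ?edge_edges //.
rewrite !inphi !phiE // 1?ltnW // gS -/(edge l i) /D.
by case: (g l i); case: (_ \in S); case: (_ \in T).
Qed.

(** * Automorphisms permute the pages *)

(** Degree at least 3, given by a list of neighbours so that [map] transports it along an
    automorphism. *)
Definition branching x := exists s : seq V, [/\ uniq s, size s = 3 & all (book x) s].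

(** The only neighbours are the two adjacent vertices of the cycle, so two of any three neighbours
    coincide. *)
Lemma branching_inr l j : ~ branching (inr (l, j)).
Proof.
case=> -[|a [|b [|c [|? ?]]]] [] //= us _ /and4P[/bookP A /bookP B /bookP C _].
have nb y : (exists l' i, i < m /\ (inr (l, j) = vtx l' i /\ y = vtx l' i.+1 \/
     y = vtx l' i /\ inr (l, j) = vtx l' i.+1)) -> y = vtx l j.+2 \/ y = vtx l j.
  move=> [l' [i [im [[xE ->]|[-> xE]]]]]; [left|right].
    by move: xE; case: (vtxP l' i (ltnW im)) => // j' -> [-> ->].
  by move: xE; case: (vtxP l' i.+1 im) => // j' [->] [-> ->].
move: us; rewrite !inE => /and3P[].
by case: (nb _ A) => ->; case: (nb _ B) => ->; case: (nb _ C) => ->; rewrite ?eqxx ?orbT.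
Qed.

(** The three neighbours are the other end of [uv] and the adjacent inner vertices on two different
    pages. *)
Lemma branching_inl b : 1 < n -> branching (inl b).
Proof.
move=> n1; pose l0 := Ordinal (ltnW n1); pose l1 := Ordinal n1.
have H0 : 0 < m - 2 by lia.
have H1 : (m - 2).-1 < m - 2 by lia.
have mE : (m - 2).+1 = m.-1 by lia.
case: b.
  exists [:: u; inr (l0, Ordinal H1); inr (l1, Ordinal H1)]; split=> //=.
  apply/and4P; split=> //; apply/bookP.
  - by exists l0, m.-1; rewrite prednK ?vtxm ?vtx_last; [auto|lia].
  - exists l0, (m - 2); rewrite -vtx_inr -[inl true](vtx_last l0) /= prednK //.
    by rewrite mE; split; [lia|auto].
  - exists l1, (m - 2); rewrite -vtx_inr -[inl true](vtx_last l1) /= prednK //.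
    by rewrite mE; split; [lia|auto].
exists [:: v; inr (l0, Ordinal H0); inr (l1, Ordinal H0)]; split=> //=.
apply/and4P; split=> //; apply/bookP.
- by exists l0, m.-1; rewrite prednK ?vtxm ?vtx_last; [auto|lia].
- by exists l0, 0; rewrite -vtx_inr; split; [lia|auto].
- by exists l1, 0; rewrite -vtx_inr; split; [lia|auto].
Qed.

Lemma aut_branching f x : graph_aut (@book m n) f -> branching x -> branching (f x).
Proof.
move=> /graph_autP fA [s [us ss xs]]; exists (map f s).
rewrite map_inj_uniq ?size_map ?all_map; last exact: perm_inj.
by split=> //; rewrite (eq_all (a2 := book x)) // => y /=; rewrite fA.
Qed.

(* For [n > 1], [u] and [v] are the only vertices of degree at least 3; removing
   them leaves one connected component per page. *)
Lemma aut_cycle f l : graph_aut (@book m n) f ->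
  exists l', forall x, x \in book_cycle m l -> f x \in book_cycle m l'.
Proof.
move=> fA; case: (ltnP 1 n) => [n1|n1]; last first.
  (* With a single page, every vertex lies on it. *)
  exists l => x _; case: (f x) => [b|[l' j]]; first exact: mem_book_cycle_inl.
  by rewrite mem_book_cycle_inr; apply/eqP/val_inj => /=; have := ltn_ord l; have := ltn_ord l'; lia.
have f_inr l1 j : exists p, f (inr (l1, j)) = inr p.
  case fx: (f _) => [b|p]; last by exists p.
  have := aut_branching _ _ (aut_inv fA) (branching_inl b n1).
  by rewrite -fx permK => /branching_inr.
have H0 : 0 < m - 2 by lia.
have [[l' j'] fl] := f_inr l (Ordinal H0).
exists l' => -[b _|[l1 j]].
  case fx: (f _) => [b'|[l2 j2]]; first exact: mem_book_cycle_inl.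
  by have := aut_branching _ _ fA (branching_inl b n1); rewrite fx => /branching_inr.
rewrite mem_book_cycle_inr => /eqP-> {l1}.
(* Induction along the inner path: consecutive inner vertices have adjacent inner images, and
   adjacent inner vertices share a page. *)
case: j => k; elim: k => [|k IHk] km.
  by rewrite (bool_irrelevance km H0) fl mem_book_cycle_inr.
have km' := ltnW km; move: (IHk km').
have : book (f (inr (l, Ordinal km'))) (f (inr (l, Ordinal km))).
  rewrite (graph_autP _ _ fA); apply/bookP; exists l, k.+1.
  by rewrite -!vtx_inr; split; [lia|auto].
have [[l1 j1] ->] := f_inr l (Ordinal km').
have [[l2 j2] ->] := f_inr l (Ordinal km).
rewrite !mem_book_cycle_inr => bk /eqP <-; apply/eqP.
case/bookP: bk => l3 [i [im [[]|[]]]].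
  by case: (vtxP l3 i (ltnW im)) => // ? _ [-> _]; case: (vtxP l3 i.+1 im) => // ? _ [-> _].
by case: (vtxP l3 i (ltnW im)) => // ? _ [-> _]; case: (vtxP l3 i.+1 im) => // ? _ [-> _].
Qed.

(** One inclusion suffices, since all pages have [m] edges. *)
Lemma aut_page f l : graph_aut (@book m n) f ->
  exists l', page l' == [set f @: (d : {set V}) | d in page l].
Proof.
move=> fA; have [l' fl] := aut_cycle f l fA; exists l'.
rewrite eq_sym eqEcard card_imset ?card_page ?leqnn ?andbT; last exact/imset_inj/perm_inj.
apply/subsetP=> _ /imsetP[d + ->]; rewrite !inE => /andP[dE /subsetP dl].
rewrite aut_edges // dE /=; apply/subsetP=> _ /imsetP[x xd ->].
exact/fl/dl.
Qed.

Definition num_odd_pages S : nat := #|[set l | odd_page S l]|.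

Lemma num_odd_pages_aut f S : graph_aut (@book m n) f ->
  num_odd_pages [set f @: (d : {set V}) | d in S] = num_odd_pages S.
Proof.
move=> fA; have fI := imset_inj (@perm_inj _ f).
(* [h] is the induced map on pages; being injective on a finite set, it preserves cardinality under
   preimage. *)
pose h l := xchoose (aut_page f l fA).
have hE l : page (h l) = [set f @: (d : {set V}) | d in page l].
  exact/eqP/(xchooseP (aut_page f l fA)).
have hI : injective h.
  by move=> l l' /(congr1 page); rewrite !hE => /(imset_inj fI)/page_inj.
rewrite /num_odd_pages -(card_preimset _ hI); apply: eq_card => l.
rewrite !inE !odd_pageE hE big_imset /=; last by move=> ? ? _ _ /fI.
by apply: eq_bigr => d _; rewrite mem_imset.
Qed.

(** * Realizing page permutations and classifying signatures *)

Definition page_perm_fun (s : 'S_n) x : V :=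
  match x with inl b => inl b | inr lj => inr (s lj.1, lj.2) end.

Lemma page_perm_funK s : cancel (page_perm_fun s) (page_perm_fun s^-1%g).
Proof. by case=> [//|[l j]] /=; rewrite permK. Qed.

Definition page_perm (s : 'S_n) : {perm V} := perm (can_inj (page_perm_funK s)).

Lemma page_perm_vtx s l i : page_perm s (vtx l i) = vtx (s l) i.
Proof.
case: (ltnP i m) => im; last by rewrite /vtx !nth_default ?size_book_cycle // permE.
by case: (vtxP l i (ltnW im)) => [->|->|->|j ->]; rewrite permE ?vtx_last ?vtxm ?vtx_inr.
Qed.

Lemma page_perm_aut s : graph_aut (@book m n) (page_perm s).
Proof.
have sub t x y : book x y -> book (page_perm t x) (page_perm t y).
  case/bookP=> l [i [im H]]; apply/bookP; exists (t l), i; split=> //.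
  by rewrite -!page_perm_vtx; case: H => -[-> ->]; auto.
apply/graph_autP=> x y; apply/idP/idP; last exact: sub.
move/(sub s^-1%g); suff K z : page_perm s^-1 (page_perm s z) = z by rewrite !K.
by rewrite !permE page_perm_funK.
Qed.

Lemma switching_iso_num_odd_pages S T : S \in sigs -> T \in sigs ->
  switching_iso (@book m n) S T = (num_odd_pages S == num_odd_pages T).
Proof.
move=> sS sT; apply/switching_isoP/eqP => // [[f fA eqT]|eqN].
  rewrite -(num_odd_pages_aut f S fA) /num_odd_pages; apply: eq_card => l.
  by rewrite !inE (odd_page_equiv _ _ _ eqT).
have [s sE] : exists s : 'S_n, forall l, odd_page T (s l) = odd_page S l.
  by apply: eq_card_perm; rewrite -[LHS]cardsE -[RHS]cardsE.
have fA := page_perm_aut s; exists (page_perm s) => //.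
apply: equiv_odd_page => [//||l]; first exact: aut_sig.
rewrite -(permKV s l) sE; apply: eq_bigr => i _.
by rewrite /edge -!page_perm_vtx mem_imset_edge.
Qed.

Lemma num_odd_pages_lt S : num_odd_pages S < n.+1.
Proof. by rewrite ltnS -[X in _ <= X](card_ord n) max_card. Qed.

Lemma num_odd_pages_surj k : k <= n -> exists2 S, S \in sigs & num_odd_pages S = k.
Proof.
(* The first edge of a page ends at the inner vertex [vtx l 1], so it belongs to that page alone,
   and exactly the first [k] pages become odd. *)
move=> kn; pose S := [set edge l 0 | l : 'I_n & l < k].
have H0 : 0 < m - 2 by lia.
have edgeS l i : i < m -> (edge l i \in S) = (i == 0) && (l < k).
  move=> im; apply/imsetP/andP => [[l' + eE]|[/eqP-> lk]]; last by exists l; rewrite ?inE.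
  rewrite inE => l'k; suff ll' : l' = l.
    by split; [apply/eqP/(edge_inj l); rewrite // ?eE ?ll' //; lia|rewrite -ll'].
  have : vtx l' 1 \in edge l i by rewrite eE !inE eqxx orbT.
  rewrite (vtx_inr l' (Ordinal H0)) => /set2P[]E; apply/eqP;
    by rewrite -(mem_book_cycle_inr l l' (Ordinal H0)) E mem_vtx.
exists S.
  rewrite powersetE; apply/subsetP=> _ /imsetP[l _ ->].
  by rewrite edge_edges //; lia.
transitivity (\sum_(l < n | l < k) 1); last by rewrite (big_ord_narrow kn) sum1_card card_ord.
rewrite sum1_card; apply: eq_card => l; rewrite !inE /odd_page big_ltn; last lia.
rewrite big_nat big1 ?edgeS ?addbF //; first by lia.
by move=> [|i] // /andP[_ im]; rewrite edgeS.
Qed.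

End Book.

Theorem theorem4p2 (m n : nat) (hm : 3 <= m) (hn : 1 <= n) :
  num_switching_iso_classes (@book m n) = n.+1.
Proof.
pose N S : 'I_n.+1 := Ordinal (num_odd_pages_lt m n S).
have Nsurj k : exists2 S, S \in signatures (@book m n) & N S = k.
  have [S sS SE] := num_odd_pages_surj _ n hm k (ltn_ord k).
  by exists S => //; apply: val_inj.
(* The classes are the fibres of [N]; surjectivity makes the fibres nonempty, hence pairwise
   distinct. *)
pose fiber k := [set S in signatures (@book m n) | k == N S].
have fiber_inj : injective fiber.
  move=> k k'; have [S] := Nsurj k; rewrite powersetE => sS <-.
  by move/setP/(_ S); rewrite !inE eqxx sS => /esym/eqP.
rewrite -[RHS]card_ord -cardsT -(card_imset _ fiber_inj).
congr #|pred_of_set _|; apply/setP=> C; apply/imsetP/imsetP => [[S sS ->]|[k _ ->]].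
  exists (N S) => //; apply/setP=> T; rewrite !inE; case sT: (T \subset _) => //=.
  by rewrite switching_iso_num_odd_pages // powersetE.
have [S sS <-] := Nsurj k; exists S => //.
apply/setP=> T; rewrite !inE; case sT: (T \subset _) => //=.
by rewrite switching_iso_num_odd_pages // powersetE.
Qed.
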